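(* The edge generating series of the Grand Motzkin lattices is $$\sum_{n\ge0}\ell(\mathcal{GM}_n)x^n=\frac{2x^2}{(1-3x)\sqrt{1-2x-3x^2}}.$$ Moreover, for every $n\ge0$: $$\ell(\mathcal{GM}_{n+2})=2\sum_{k=0}^nT_k\,3^{n-k}=\frac{2}{4^n}\sum_{k=0}^n\binom{2k}{k}\binom{2n-2k}{n-k}(2k+1)3^k(-1)^{n-k}=2\sum_{k=0}^n\binom{n+1}{k+1}\binom{2k}{k}(-1)^k3^{n-k}.$$ Finally, $\ell(\mathcal{GM}_n)\sim 2\cdot3^{n-2}\sqrt{3n/\pi}$ and $i(\mathcal{GM}_n)\sim\frac49 n$.
   Context: Steps: $U=(1,1)$, $D=(1,-1)$, $H=(1,0)$. $\mathcal{GM}_n$ is the set of all lattice paths from $(0,0)$ to $(n,0)$ with steps $U,D,H$, partially ordered by $\gamma_1\le\gamma_2$ iff $\gamma_1$ lies weakly below $\gamma_2$. $\ell(P)$ is the number of edges (covering pairs) of the Hasse diagram of a finite poset $P$ and $i(P)=\ell(P)/|P|$. $T_k=[x^k](1+x+x^2)^k$ is the central trinomial coefficient (so $|\mathcal{GM}_n|=T_n$). $a_n\sim b_n$ means $a_n/b_n\to1$. *)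

(* Defs.v *)
From Stdlib Require Import Reals ZArith Arith List Bool.
Import ListNotations.

Inductive step : Type := U | D | H.

Definition step_eq_dec (a b : step) : {a = b} + {a <> b}.
Proof. decide equality. Defined.

Definition dy (s : step) : Z :=
  match s with U => 1%Z | D => (-1)%Z | H => 0%Z end.

Fixpoint words (n : nat) : list (list step) :=
  match n with
  | O => [ [] ]
  | S m => flat_map (fun w => [U :: w; D :: w; H :: w]) (words m)
  end.

Fixpoint heights (h : Z) (w : list step) : list Z :=
  match w with
  | [] => []
  | s :: w' => (h + dy s)%Z :: heights (h + dy s)%Z w'
  end.

Definition final_height (w : list step) : Z := fold_left (fun h s => (h + dy s)%Z) w 0%Z.

Definition GM (n : nat) : list (list step) :=
  filter (fun w => Z.eqb (final_height w) 0) (words n).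

Fixpoint pointwise_leb (a b : list Z) : bool :=
  match a, b with
  | [], [] => true
  | x :: a', y :: b' => Z.leb x y && pointwise_leb a' b'
  | _, _ => false
  end.

(* g1 <= g2 iff g1 lies weakly below g2 (heights compared at every abscissa;
   paths are piecewise linear between integer abscissas, height 0 at x=0) *)
Definition GM_le (g1 g2 : list step) : bool :=
  pointwise_leb (heights 0 g1) (heights 0 g2).

Definition GM_lt (g1 g2 : list step) : bool :=
  GM_le g1 g2 && (if list_eq_dec step_eq_dec g1 g2 then false else true).

Definition GM_covers (n : nat) (g1 g2 : list step) : bool :=
  GM_lt g1 g2 && negb (existsb (fun g => GM_lt g1 g && GM_lt g g2) (GM n)).

Definition ell (n : nat) : nat :=
  length (filter (fun p => GM_covers n (fst p) (snd p)) (list_prod (GM n) (GM n))).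

Definition iGM (n : nat) : R := INR (ell n) / INR (length (GM n)).

(* polynomials with nat coefficients as coefficient lists (low degree first) *)
Fixpoint padd (p q : list nat) : list nat :=
  match p, q with
  | [], q => q
  | p, [] => p
  | a :: p', b :: q' => (a + b) :: padd p' q'
  end.

Fixpoint pmul (p q : list nat) : list nat :=
  match p with
  | [] => []
  | a :: p' => padd (map (Nat.mul a) q) (0 :: pmul p' q)
  end.

Fixpoint ppow (p : list nat) (k : nat) : list nat :=
  match k with O => [1] | S m => pmul p (ppow p m) end.

Definition T (k : nat) : nat := nth k (ppow [1; 1; 1] k) 0.

(* Main.v *)
From Coquelicot Require Import Rcomplements Rbar Hierarchy Lim_seq Series PSeries Derive Continuity
  RInt RInt_analysis AutoDerive.
Require Import Defs.
From Stdlib Require Import Reals ZArith Arith List Lia Lra Bool Permutation.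
Import ListNotations.
Open Scope R_scope.

(** A covering raises one interior height by one, i.e. turns a factor [s1 s2] with [s1] in {D, H} and
    [s2] in {U, H} into the factor with [s1] one higher and [s2] one lower. With [F = t + a + 1/t]
    and [a = 1], such factors are counted by [(1/t + 1) (1 + t) = F + 1], so placing one at any of the
    [n + 1] positions gives [ell (n + 2) = (n + 1) (T_n + T_{n+1})].
    Differentiating the powers of [F] yields a recurrence for the constant terms of
    [F^n]: for [a = 1] these are the [T_n], for [a = -2] they are [(-1)^n C(2n, n)]. The recurrence
    turns [(n + 1) (T_n + T_{n+1})] into [2 sum_k T_k 3^(n-k)], the shift [1 = -2 + 3] gives the
    alternating sum, and the factorization [1 - 2x - 3x^2 = (1 - 3x) (1 + x)] writes [T] as a
    convolution of geometrically weighted [cbin k = C(2k, k) / 4^k].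
    Wallis' product gives [cbin k ~ 1 / sqrt (PI k)], and dominated convergence in the convolution gives
    [T_n ~ 3^n sqrt (3 / (4 PI n))], from which both asymptotic statements follow. *)

(** * Coverings and paths *)

(** The vertex between [s1] and [s2] moves up by one: [s1] gains one and [s2] loses one. A list of
    at most one word, empty when no such steps exist, so that [raises] can concatenate. *)
Definition hill (s1 s2 : step) (w : list step) : list (list step) :=
  match s1, s2 with
  | D, U => [H :: H :: w]
  | D, H => [H :: D :: w]
  | H, U => [U :: H :: w]
  | H, H => [U :: D :: w]
  | _, _ => []
  end.

Fixpoint raises (w : list step) : list (list step) :=
  match w with
  | s1 :: ((s2 :: w') as t) => hill s1 s2 w' ++ map (cons s1) (raises t)
  | _ => []
  end.

(** Up to an additive constant, the rank function of the lattice. *)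
Definition area (w : list step) : Z := fold_right Z.add 0%Z (heights 0 w).

Lemma fold_height (w : list step) (h : Z) :
  fold_left (fun h s => (h + dy s)%Z) w h = (h + final_height w)%Z.
Proof.
  unfold final_height; revert h.
  induction w as [|s w IH]; intro h; simpl; [lia|].
  rewrite IH, (IH (dy s)); lia.
Qed.

Lemma final_height_cons (s : step) (w : list step) :
  final_height (s :: w) = (dy s + final_height w)%Z.
Proof. unfold final_height at 1; simpl. now rewrite fold_height. Qed.

Lemma raises_cons_cases (s : step) (w g : list step) :
  In g (raises (s :: w)) ->
  (exists s' t, w = s' :: t /\ In g (hill s s' t)) \/
  (exists g', g = s :: g' /\ In g' (raises w)).
Proof.
  destruct w as [|s' t]; simpl; [easy|].
  intros Hg; apply in_app_or in Hg; destruct Hg as [Hg|Hg]; [left; eauto|right].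
  apply in_map_iff in Hg; destruct Hg as [g' [<- Hg]]; eauto.
Qed.

Lemma raises_cons (s : step) (w g : list step) :
  In g (raises w) -> In (s :: g) (raises (s :: w)).
Proof.
  destruct w as [|s' t]; [easy|].
  intros Hg; change (In (s :: g) (hill s s' t ++ map (cons s) (raises (s' :: t)))).
  apply in_or_app; right; now apply in_map.
Qed.

Lemma raises_hill (s s' : step) (t g : list step) :
  In g (hill s s' t) -> In g (raises (s :: s' :: t)).
Proof. intros Hg; simpl; apply in_or_app; now left. Qed.

Lemma hill_spec (s1 s2 : step) (t g : list step) :
  In g (hill s1 s2 t) <->
  exists r1 r2, g = r1 :: r2 :: t /\ (dy r1 = dy s1 + 1)%Z /\ (dy r2 = dy s2 - 1)%Z.
Proof.
  split.
  - destruct s1, s2; simpl; intros Hg; try easy; destruct Hg as [<-|[]]; do 2 eexists;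
    (split; [reflexivity|split; reflexivity]).
  - intros (r1 & r2 & -> & E1 & E2).
    destruct s1, s2, r1, r2; simpl in *; try lia; now left.
Qed.

Lemma pointwise_leb_cons (x y : Z) (a b : list Z) :
  pointwise_leb (x :: a) (y :: b) = true <-> (x <= y)%Z /\ pointwise_leb a b = true.
Proof. simpl; rewrite andb_true_iff, Z.leb_le; tauto. Qed.

Lemma pointwise_leb_refl (a : list Z) : pointwise_leb a a = true.
Proof. induction a; [easy|]. rewrite pointwise_leb_cons; split; [lia|easy]. Qed.

(** The two changed steps keep their total, so only the height between them moves. The free start
    [h] carries the induction past a common prefix. *)
Lemma raises_heights (w g : list step) (h : Z) :
  In g (raises w) ->
  pointwise_leb (heights h w) (heights h g) = true /\
  fold_right Z.add 0%Z (heights h g) = (fold_right Z.add 0 (heights h w) + 1)%Z /\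
  length g = length w /\ final_height g = final_height w.
Proof.
  revert g h; induction w as [|s w IH]; intros g h Hg; [easy|].
  apply raises_cons_cases in Hg.
  destruct Hg as [(s' & t & -> & Hg)|(g' & -> & Hg)].
  - apply hill_spec in Hg; destruct Hg as (r1 & r2 & -> & E1 & E2).
    cbn [heights]; rewrite !pointwise_leb_cons, !final_height_cons, E1, E2.
    replace (h + (dy s + 1) + (dy s' - 1))%Z with (h + dy s + dy s')%Z by lia.
    cbn [length fold_right]. repeat split; try lia. apply pointwise_leb_refl.
  - destruct (IH g' (h + dy s)%Z Hg) as (I1 & I2 & I3 & I4).
    cbn [heights]; rewrite !pointwise_leb_cons, !final_height_cons.
    cbn [length fold_right]. repeat split; try lia; easy.
Qed.

Lemma pointwise_leb_sum (a b : list Z) :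
  pointwise_leb a b = true -> (fold_right Z.add 0 a <= fold_right Z.add 0 b)%Z.
Proof.
  revert b; induction a as [|x a IH]; intros [|y b]; try easy.
  rewrite pointwise_leb_cons; intros [I J]; apply IH in J; simpl; lia.
Qed.

(** Equal sums leave no room for a strict inequality at any abscissa, and heights determine the
    steps. *)
Lemma heights_eq_of_sum (w1 w2 : list step) (h : Z) :
  pointwise_leb (heights h w1) (heights h w2) = true ->
  fold_right Z.add 0%Z (heights h w1) = fold_right Z.add 0%Z (heights h w2) ->
  w1 = w2.
Proof.
  revert w2 h; induction w1 as [|s w1 IH]; intros [|t w2] h; try easy.
  cbn [heights]; rewrite pointwise_leb_cons; intros [I J] E.
  cbn [fold_right] in E.
  assert (K := pointwise_leb_sum _ _ J).
  assert (E' : dy s = dy t) by lia.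
  rewrite E' in *. f_equal.
  - destruct s, t; simpl in E'; congruence || lia.
  - apply (IH w2 (h + dy t)%Z); [easy|lia].
Qed.

(* From a strict position entered by a non-up step, follow the descending run of the lower path:
   strictness persists along it, so the run must end at a valley or corner that can be raised. *)
Lemma raise_on_descent (w1 w2 : list step) (s : step) (h h2 : Z) :
  s <> U -> (h + dy s < h2)%Z ->
  pointwise_leb (heights (h + dy s) w1) (heights h2 w2) = true ->
  (h + dy s + final_height w1 = h2 + final_height w2)%Z ->
  exists g, In g (raises (s :: w1)) /\
    pointwise_leb (heights h g) (h2 :: heights h2 w2) = true.
Proof.
  revert w2 s h h2; induction w1 as [|r w1 IH]; intros [|r2 w2] s h h2 Hs Hlt Hle Hf; try easy.
  - simpl in Hf; unfold final_height in Hf; simpl in Hf; lia.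
  - cbn [heights] in Hle; rewrite pointwise_leb_cons in Hle; destruct Hle as [Hr Hle].
    rewrite !final_height_cons in Hf.
    (* The upper path drops by at most one, so if the lower path goes down the gap persists and the
       run continues with [D] in the role of [s]. Otherwise [r] can be lowered while [s] is lifted,
       and the strict gap makes room for this. *)
    assert (Hd : (dy r2 >= -1)%Z) by (destruct r2; simpl; lia).
    assert (Hcase : r = D \/ (exists r', dy r' = dy r - 1)%Z).
    { destruct r; [right; now exists H|now left|right; now exists D]. }
    destruct Hcase as [->|[r' Hr']].
    + destruct (IH w2 D (h + dy s)%Z (h2 + dy r2)%Z) as (g & Ig & Lg); try easy; try (simpl dy in *; lia).
      exists (s :: g); split; [now apply raises_cons|].
      cbn [heights]; rewrite pointwise_leb_cons; split; [lia|easy].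
    + assert (exists s', dy s' = dy s + 1)%Z as [s' Hs'].
      { destruct s; [easy|now exists H|now exists U]. }
      exists (s' :: r' :: w1); split.
      * apply raises_hill, hill_spec; now exists s', r'.
      * cbn [heights]; rewrite !pointwise_leb_cons, Hs', Hr'.
        replace (h + (dy s + 1) + (dy r - 1))%Z with (h + dy s + dy r)%Z by lia.
        repeat split; try lia; easy.
Qed.

(** At the first disagreement both paths are at the same height, so the lower one takes the smaller
    step. That step is not [U], and a strict gap opens: the situation of [raise_on_descent]. *)
Lemma exists_raise_below (w1 w2 : list step) (h : Z) :
  pointwise_leb (heights h w1) (heights h w2) = true ->
  final_height w1 = final_height w2 -> w1 <> w2 ->
  exists g, In g (raises w1) /\ pointwise_leb (heights h g) (heights h w2) = true.
Proof.
  revert w2 h; induction w1 as [|s w1 IH]; intros [|t w2] h Hle Hf Hne; try easy.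
  cbn [heights] in Hle; rewrite pointwise_leb_cons in Hle; destruct Hle as [Hst Hle].
  rewrite !final_height_cons in Hf.
  destruct (step_eq_dec s t) as [->|Hs].
  - destruct (IH w2 (h + dy t)%Z) as (g & Ig & Lg); [easy|lia|congruence|].
    exists (t :: g); split; [now apply raises_cons|].
    cbn [heights]; rewrite pointwise_leb_cons; split; [lia|easy].
  - apply raise_on_descent; try easy; try lia.
    + intros ->; destruct t; simpl in *; congruence || lia.
    + destruct s, t; simpl in *; congruence || lia.
Qed.

Lemma in_words (n : nat) (w : list step) : In w (words n) <-> length w = n.
Proof.
  revert w; induction n as [|n IH]; intro w; simpl.
  - split; [now intros [<-|[]]|]. destruct w; [now left|easy].
  - rewrite in_flat_map; split.
    + intros (v & Hv & [<-|[<-|[<-|[]]]]); simpl; f_equal; now apply IH.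
    + destruct w as [|s v]; [easy|]. intros E; exists v; split; [apply IH; now injection E|].
      destruct s; simpl; tauto.
Qed.

Lemma words_NoDup (n : nat) : NoDup (words n).
Proof.
  induction n as [|n IH]; [repeat constructor; easy|]. simpl.
  induction IH as [|w l Hw Hl IHl]; simpl; [constructor|].
  assert (K : forall s, ~ In (s :: w)
      (flat_map (fun w => [U :: w; D :: w; H :: w]) l)).
  { intros s I; apply in_flat_map in I; destruct I as (v & Hv & I); apply Hw.
    destruct I as [E|[E|[E|[]]]]; injection E; intros; subst; easy. }
  repeat constructor; simpl; try apply IHl; intros I;
  repeat (destruct I as [I|I]; [discriminate|]); now apply K in I.
Qed.

Lemma in_GM (n : nat) (w : list step) :
  In w (GM n) <-> length w = n /\ final_height w = 0%Z.
Proof. unfold GM; rewrite filter_In, in_words, Z.eqb_eq; tauto. Qed.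

(** Raising the first interior vertex changes the first step, while raising any later one keeps
    it. *)
Lemma NoDup_raises (w : list step) : NoDup (raises w).
Proof.
  induction w as [|s w IH]; [constructor|].
  destruct w as [|s' t]; [constructor|].
  assert (M : NoDup (map (cons s) (raises (s' :: t)))).
  { apply FinFun.Injective_map_NoDup; [|easy]. intros x y E; now injection E. }
  assert (K : forall g, In g (hill s s' t) -> ~ In g (map (cons s) (raises (s' :: t)))).
  { intros g Hg I; apply in_map_iff in I; destruct I as (v & <- & _).
    apply hill_spec in Hg; destruct Hg as (r1 & r2 & E & E1 & _).
    injection E; intros; subst; lia. }
  change (NoDup (hill s s' t ++ map (cons s) (raises (s' :: t)))).
  revert K M; generalize (map (cons s) (raises (s' :: t))) as l; intros l K M.
  destruct s, s'; simpl in *; try easy; constructor; try easy; apply K; now left.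
Qed.

Lemma GM_lt_iff (g1 g2 : list step) :
  GM_lt g1 g2 = true <-> GM_le g1 g2 = true /\ g1 <> g2.
Proof.
  unfold GM_lt; rewrite andb_true_iff.
  destruct (list_eq_dec step_eq_dec g1 g2); split; intros []; split; easy.
Qed.

Lemma GM_lt_area (g1 g2 : list step) : GM_lt g1 g2 = true -> (area g1 < area g2)%Z.
Proof.
  rewrite GM_lt_iff; intros [L N].
  assert (I := pointwise_leb_sum _ _ L).
  destruct (Z.eq_dec (area g1) (area g2)) as [E|E]; [|unfold area in *; lia].
  destruct N; now apply heights_eq_of_sum with 0%Z.
Qed.

(** Below the upper path of a covering there is a raise of the lower one, which must be the upper
    path itself. Conversely a raise adds one to [area], and no integer lies strictly between. *)
Lemma GM_covers_iff (n : nat) (g1 g2 : list step) :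
  In g1 (GM n) -> In g2 (GM n) ->
  (GM_covers n g1 g2 = true <-> In g2 (raises g1)).
Proof.
  intros I1 I2; unfold GM_covers; rewrite andb_true_iff, negb_true_iff.
  assert (Rlt : forall g, In g (raises g1) -> GM_lt g1 g = true).
  { intros g Hg; destruct (raises_heights _ _ 0 Hg) as (L & A & _).
    apply GM_lt_iff; split; [easy|intros ->; lia]. }
  split.
  - intros [L N]. assert (L' := L). apply GM_lt_iff in L'; destruct L' as [Le Ne].
    apply in_GM in I1; apply in_GM in I2.
    destruct (exists_raise_below g1 g2 0) as (g & Ig & Lg); try easy; [lia|].
    destruct (list_eq_dec step_eq_dec g g2) as [<-|Hne]; [easy|].
    exfalso; rewrite <- not_true_iff_false, existsb_exists in N; apply N.
    exists g; rewrite in_GM, andb_true_iff; split.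
    + destruct (raises_heights _ _ 0 Ig) as (_ & _ & ? & ?); split; [lia|]; lia.
    + split; [now apply Rlt|now apply GM_lt_iff].
  - intros Hg; split; [now apply Rlt|].
    apply not_true_iff_false; rewrite existsb_exists; intros (g & _ & G).
    apply andb_true_iff in G; destruct G as [G1 G2].
    apply GM_lt_area in G1; apply GM_lt_area in G2.
    destruct (raises_heights _ _ 0 Hg) as (_ & A & _); unfold area in *; lia.
Qed.

Definition sum_list {A : Type} (f : A -> R) (l : list A) : R :=
  fold_right (fun a s => f a + s) 0 l.

Lemma sum_list_ext {A : Type} (f g : A -> R) (l : list A) :
  (forall a, In a l -> f a = g a) -> sum_list f l = sum_list g l.
Proof.
  induction l as [|a l IH]; intros E; simpl; [easy|].
  rewrite (E a) by now left. f_equal; apply IH; intros; apply E; now right.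
Qed.

Lemma INR_length_filter {A : Type} (p : A -> bool) (l : list A) :
  INR (length (filter p l)) = sum_list (fun a => if p a then 1 else 0) l.
Proof.
  induction l as [|a l IH]; simpl; [easy|].
  rewrite <- IH; destruct (p a); cbn [length]; rewrite ?S_INR; lra.
Qed.

Lemma sum_list_filter {A : Type} (p : A -> bool) (f : A -> R) (l : list A) :
  sum_list f (filter p l) = sum_list (fun a => if p a then f a else 0) l.
Proof.
  induction l as [|a l IH]; simpl; [easy|].
  rewrite <- IH; destruct (p a); simpl; lra.
Qed.

Lemma length_filter_list_prod {A B : Type} (p : A * B -> bool) (l : list A) (m : list B) :
  INR (length (filter p (list_prod l m))) =
  sum_list (fun a => INR (length (filter (fun b => p (a, b)) m))) l.
Proof.
  induction l as [|a l IH]; simpl; [easy|].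
  rewrite filter_app, length_app, plus_INR, IH; f_equal.
  f_equal; clear. induction m as [|b m IH]; simpl; [easy|].
  destruct (p (a, b)); simpl; now rewrite IH.
Qed.

Lemma ell_sum_raises (n : nat) :
  INR (ell n) = sum_list (fun g => INR (length (raises g))) (GM n).
Proof.
  unfold ell; rewrite length_filter_list_prod; apply sum_list_ext; intros g Hg; simpl.
  f_equal; apply Permutation_length, NoDup_Permutation.
  - apply NoDup_filter, NoDup_filter, words_NoDup.
  - apply NoDup_raises.
  - intros g'; rewrite filter_In; split.
    + intros [I J]; now apply GM_covers_iff in J.
    + intros I. assert (I' : In g' (GM n)).
      { destruct (raises_heights _ _ 0 I) as (_ & _ & E1 & E2).
        apply in_GM in Hg; apply in_GM; split; [lia|]; lia. }
      split; [easy|]. now apply GM_covers_iff.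
Qed.

(** All final heights [z] are kept, not only 0, so that removing a first step gives a closed
    recurrence. *)
Definition wsum (f : list step -> R) (n : nat) (z : Z) : R :=
  sum_list (fun w => if Z.eqb (final_height w) z then f w else 0) (words n).

Lemma wsum_S (f : list step -> R) (n : nat) (z : Z) :
  wsum f (S n) z = wsum (fun w => f (U :: w)) n (z - 1) +
    wsum (fun w => f (H :: w)) n z + wsum (fun w => f (D :: w)) n (z + 1).
Proof.
  unfold wsum; simpl; induction (words n) as [|w l IH]; simpl; [lra|].
  rewrite IH, !final_height_cons; simpl dy.
  replace (1 + final_height w =? z)%Z with (final_height w =? z - 1)%Z
    by (apply eq_true_iff_eq; rewrite !Z.eqb_eq; lia).
  replace (-1 + final_height w =? z)%Z with (final_height w =? z + 1)%Z
    by (apply eq_true_iff_eq; rewrite !Z.eqb_eq; lia).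
  replace (0 + final_height w =? z)%Z with (final_height w =? z)%Z
    by (apply eq_true_iff_eq; rewrite !Z.eqb_eq; lia).
  lra.
Qed.

Lemma wsum_plus (f g : list step -> R) (n : nat) (z : Z) :
  wsum (fun w => f w + g w) n z = wsum f n z + wsum g n z.
Proof.
  unfold wsum; induction (words n) as [|w l IH]; simpl; [lra|].
  rewrite IH; destruct (final_height w =? z)%Z; lra.
Qed.

Lemma wsum_ext (f g : list step -> R) (n : nat) (z : Z) :
  (forall w, f w = g w) -> wsum f n z = wsum g n z.
Proof. intros E; apply sum_list_ext; intros w _; now rewrite E. Qed.

Lemma wsum_0 (n : nat) (z : Z) : wsum (fun _ => 0) n z = 0.
Proof.
  unfold wsum; induction (words n) as [|w l IH]; simpl; [easy|].
  rewrite IH; destruct (final_height w =? z)%Z; lra.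
Qed.

Notation paths := (wsum (fun _ => 1)).
Notation edges := (wsum (fun w => INR (length (raises w)))).

Lemma length_raises (s1 s2 : step) (w : list step) :
  INR (length (raises (s1 :: s2 :: w))) =
  INR (length (hill s1 s2 w)) + INR (length (raises (s2 :: w))).
Proof.
  change (raises (s1 :: s2 :: w)) with (hill s1 s2 w ++ map (cons s1) (raises (s2 :: w))).
  now rewrite length_app, length_map, plus_INR.
Qed.

(** Split off the first step. The later vertices give the three [edges] terms. The first vertex
    needs a first step in {H, D} and a second in {U, H}; the remaining words end at [z - 1], [z],
    [z], [z + 1], which is [paths (S n) z] plus one more [paths n z]. *)
Lemma edges_SS (n : nat) (z : Z) :
  edges (S (S n)) z = edges (S n) (z - 1) + edges (S n) z + edges (S n) (z + 1) +
    paths (S n) z + paths n z.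
Proof.
  assert (K : forall s y, wsum (fun w => INR (length (raises (s :: w)))) (S n) y =
     edges (S n) y + match s with U => 0 | _ => paths n (y - 1) + paths n y end).
  { intros s y; rewrite !(wsum_S _ n y).
    rewrite !(wsum_ext _ _ n _ (length_raises s _)), !wsum_plus.
    destruct s; simpl; rewrite ?wsum_0; lra. }
  rewrite (wsum_S _ (S n) z), !K, (wsum_S (fun _ => 1)).
  replace (z + 1 - 1)%Z with z by lia. lra.
Qed.

Lemma edges_paths (n : nat) (z : Z) :
  edges (S (S n)) z = INR (S n) * (paths (S n) z + paths n z).
Proof.
  revert z; induction n as [|n IH]; intros z; rewrite edges_SS.
  - assert (E : forall y, edges 1 y = 0).
    { intros y; unfold wsum, sum_list; cbn [words flat_map app fold_right raises length INR].
      repeat destruct (_ =? _)%Z; lra. }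
    rewrite !E; simpl INR; ring.
  - rewrite !IH, (wsum_S (fun _ => 1) (S n) z), (S_INR (S n)), (wsum_S (fun _ => 1) n z). ring.
Qed.

Lemma ell_0 : ell 0 = 0%nat.
Proof. reflexivity. Qed.

Lemma ell_1 : ell 1 = 0%nat.
Proof. reflexivity. Qed.

Lemma GM_length (n : nat) : INR (length (GM n)) = paths n 0.
Proof. unfold GM; apply INR_length_filter. Qed.

Lemma ell_paths (n : nat) :
  INR (ell (S (S n))) = INR (S n) * (paths (S n) 0 + paths n 0).
Proof.
  rewrite ell_sum_raises; unfold GM; rewrite sum_list_filter. apply edges_paths.
Qed.

(** * Trinomial and binomial identities *)

(** Coefficient of t^z in (t + a + 1/t)^n. The parameter [a] serves the values 1 and -2 at once. *)
Fixpoint trinomial (a : R) (n : nat) (z : Z) : R :=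
  match n with
  | O => if Z.eqb z 0 then 1 else 0
  | S m => trinomial a m (z - 1) + a * trinomial a m z + trinomial a m (z + 1)
  end.

Notation central a n := (trinomial a n 0).

Lemma paths_trinomial (n : nat) (z : Z) : paths n z = trinomial 1 n z.
Proof.
  revert z; induction n as [|n IH]; intros z.
  - unfold wsum, sum_list; cbn [words fold_right trinomial].
    change (final_height []) with 0%Z. rewrite Z.eqb_sym; destruct (z =? 0)%Z; ring.
  - rewrite wsum_S, !IH; simpl; ring.
Qed.

Lemma trinomial_opp (a : R) (n : nat) (z : Z) : trinomial a n (- z) = trinomial a n z.
Proof.
  revert z; induction n as [|n IH]; intros z; simpl.
  - now destruct z.
  - replace (- z - 1)%Z with (- (z + 1))%Z by lia.
    replace (- z + 1)%Z with (- (z - 1))%Z by lia.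
    rewrite !IH; ring.
Qed.

(* Coefficient form of t (F^(n+1))' = (n+1) F^n (t - 1/t) for F = t + a + 1/t. *)
Lemma trinomial_derive (a : R) (n : nat) (z : Z) :
  IZR z * trinomial a (S n) z = INR (S n) * (trinomial a n (z - 1) - trinomial a n (z + 1)).
Proof.
  revert z; induction n as [|n IH]; intros z.
  - simpl.
    destruct (Z.eqb_spec (z - 1) 0) as [e|e].
    { replace z with 1%Z by lia; simpl; ring. }
    destruct (Z.eqb_spec (z + 1) 0) as [e'|e'].
    { replace z with (-1)%Z by lia; simpl; ring. }
    destruct (Z.eqb_spec z 0) as [->|?]; simpl; ring.
  - change (trinomial a (S (S n)) z) with
      (trinomial a (S n) (z - 1) + a * trinomial a (S n) z + trinomial a (S n) (z + 1)).
    assert (E1 := IH (z - 1)%Z); assert (E2 := IH z); assert (E3 := IH (z + 1)%Z).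
    rewrite minus_IZR in E1; rewrite plus_IZR in E3.
    rewrite (S_INR (S n)).
    set (p := trinomial a (S n) (z - 1)) in *; set (q := trinomial a (S n) (z + 1)) in *.
    set (r := trinomial a (S n) z) in *.
    (* Each coefficient is weighted by its own exponent, as the induction hypotheses require; the
       leftover [p - q] raises the factor from n + 1 to n + 2. *)
    replace (IZR z * (p + a * r + q)) with
      ((IZR z - 1) * p + a * (IZR z * r) + (IZR z + 1) * q + (p - q)) by ring.
    rewrite E1, E2, E3. unfold p, q; cbn [trinomial].
    replace (z - 1 + 1)%Z with z by lia. replace (z + 1 - 1)%Z with z by lia. ring.
Qed.

(** Let [u] be the coefficient next to the centre. Symmetry expresses [central a (S k)] through
    [central a k] and [u k]; [trinomial_derive] at [z = 1] removes the coefficient of t^2 from the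
    recurrence of [u]. Eliminating [u] leaves a recurrence of order two. *)
Lemma central_rec (a : R) (n : nat) :
  INR (n + 2) * central a (S (S n)) =
  a * (2 * INR n + 3) * central a (S n) + INR (n + 1) * (4 - a * a) * central a n.
Proof.
  set (u := fun k => trinomial a k 1).
  assert (E : forall k, central a (S k) = a * central a k + 2 * u k).
  { intros k; unfold u; cbn [trinomial].
    change (0 - 1)%Z with (- (1))%Z; rewrite trinomial_opp; simpl; ring. }
  assert (Hu : INR (n + 2) * u (S n) = INR (n + 1) * (2 * central a n + a * u n)).
  { assert (K := trinomial_derive a n 1). change (1 - 1)%Z with 0%Z in K.
    assert (L : u (S n) = central a n + a * u n + trinomial a n (1 + 1)) by reflexivity.
    fold (u (S n)) in K. rewrite S_INR in K. rewrite !plus_INR; simpl INR. nra. }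
  rewrite !E. rewrite !plus_INR in *; simpl INR in *.
  replace ((INR n + (1 + 1)) * (a * (a * central a n + 2 * u n) + 2 * u (S n))) with
    ((INR n + 2) * a * (a * central a n + 2 * u n) + 2 * ((INR n + (1 + 1)) * u (S n))) by ring.
  rewrite Hu; ring.
Qed.

Lemma central_0 (a : R) : central a 0 = 1.
Proof. reflexivity. Qed.

Lemma central_1 (a : R) : central a 1 = a.
Proof. simpl; ring. Qed.

Lemma C_central_S (k : nat) :
  INR (S k) * C (2 * S k) (S k) = 2 * (2 * INR k + 1) * C (2 * k) k.
Proof.
  unfold C. replace (2 * S k - S k)%nat with (S k) by lia.
  replace (2 * k - k)%nat with k by lia.
  replace (2 * S k)%nat with (S (S (2 * k))) by lia.
  rewrite !fact_simpl, !mult_INR, !S_INR, mult_INR; simpl (INR 2).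
  assert (F := INR_fact_neq_0 k). assert (P := pos_INR k). field; lra.
Qed.

Lemma C_central_0 : C (2 * 0) 0 = 1.
Proof. unfold C; simpl; field. Qed.

Lemma central_minus_2 (k : nat) : central (-2) k = (-1) ^ k * C (2 * k) k.
Proof.
  (* At [a = -2] the factor [4 - a * a] vanishes and the order drops to one; up to sign this is the
     recurrence [C_central_S]. *)
  assert (R : forall n, INR (S n) * central (-2) (S n) = -2 * (2 * INR n + 1) * central (-2) n).
  { intros [|n]; [rewrite central_1, central_0; simpl; ring|].
    assert (K := central_rec (-2) n). rewrite !plus_INR in K; rewrite !S_INR in *; simpl INR in *.
    lra. }
  induction k as [|k IH].
  - rewrite central_0, C_central_0; ring.
  - assert (P := pos_INR k). apply Rmult_eq_reg_l with (INR (S k)); [|rewrite S_INR; lra].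
    rewrite R, IH.
    replace (INR (S k) * ((-1) ^ S k * C (2 * S k) (S k))) with
      ((-1) ^ S k * (INR (S k) * C (2 * S k) (S k))) by ring.
    rewrite C_central_S; simpl; ring.
Qed.

Lemma C_0_r (n : nat) : C n 0 = 1.
Proof.
  unfold C; rewrite Nat.sub_0_r; simpl (fact 0). assert (F := INR_fact_neq_0 n).
  simpl INR. field; easy.
Qed.

Lemma C_diag (n : nat) : C n n = 1.
Proof.
  unfold C; rewrite Nat.sub_diag; simpl (fact 0). assert (F := INR_fact_neq_0 n).
  simpl INR. field; easy.
Qed.

(** Pascal's rule under the sum, the two end terms being treated apart: the induction step of the
    binomial theorem. *)
Lemma sum_C_S (f : nat -> R) (m : nat) :
  sum_f_R0 (fun k => C (S m) k * f k) (S m) =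
  sum_f_R0 (fun k => C m k * (f k + f (S k))) m.
Proof.
  rewrite (sum_eq _ (fun k => C m k * f k + C m k * f (S k)) m) by (intros; ring).
  rewrite sum_plus.
  destruct m as [|m].
  - simpl; rewrite !C_0_r, C_diag; ring.
  - rewrite (decomp_sum _ (S (S m))) by lia. rewrite (decomp_sum (fun k => C (S m) k * f k)) by lia.
    simpl Nat.pred. rewrite !tech5, !C_0_r, !C_diag.
    rewrite (sum_eq _ (fun i => C (S m) (S i) * f (S i) + C (S m) i * f (S i)) m).
    + rewrite sum_plus; ring.
    + intros i Hi; rewrite <- pascal by lia; ring.
Qed.

(** Binomial theorem for (F + s)^m with F = t + a + 1/t, read off at t^z. *)
Lemma trinomial_shift (a s : R) (m : nat) (z : Z) :
  trinomial (a + s) m z = sum_f_R0 (fun k => C m k * (s ^ (m - k) * trinomial a k z)) m.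
Proof.
  revert z; induction m as [|m IH]; intros z.
  - simpl; rewrite C_0_r; ring.
  - rewrite sum_C_S.
    rewrite (sum_eq _ (fun k =>
        C m k * (s ^ (m - k) * trinomial a k (z - 1)) +
        C m k * (s ^ (m - k) * trinomial a k z) * (a + s) +
        C m k * (s ^ (m - k) * trinomial a k (z + 1))) m).
    + rewrite !sum_plus, <- scal_sum, <- !IH; reflexivity.
    + intros k Hk; replace (S m - k)%nat with (S (m - k)) by lia; simpl; ring.
Qed.

Lemma central_1_binomial (m : nat) :
  central 1 m = sum_f_R0 (fun k => C m k * (C (2 * k) k * (-1) ^ k * 3 ^ (m - k))) m.
Proof.
  replace 1 with (-2 + 3) at 1 by ring. rewrite trinomial_shift.
  apply sum_eq; intros k _; rewrite central_minus_2; ring.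
Qed.

Lemma nth_padd (p q : list nat) (j : nat) :
  nth j (padd p q) 0%nat = (nth j p 0 + nth j q 0)%nat.
Proof.
  revert q j; induction p as [|a p IH]; intros [|b q] [|j]; simpl; try lia; auto.
Qed.

Lemma nth_map_mul (a : nat) (q : list nat) (j : nat) :
  nth j (map (Nat.mul a) q) 0%nat = (a * nth j q 0)%nat.
Proof. revert j; induction q as [|b q IH]; intros [|j]; simpl; rewrite ?Nat.mul_0_r; auto. Qed.

(** Since (1 + x + x^2)^k = x^k (x + 1 + 1/x)^k, index [j] corresponds to exponent j - k. *)
Lemma nth_ppow_trinomial (k j : nat) :
  INR (nth j (ppow [1; 1; 1]%nat k) 0%nat) = trinomial 1 k (Z.of_nat j - Z.of_nat k).
Proof.
  revert j; induction k as [|k IH]; intros j.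
  - destruct j as [|[|j]]; simpl; reflexivity.
  - cbn [ppow pmul trinomial].
    (* For [j = 0] and [j = 1] some neighbours in the trinomial recurrence lie left of the
       support. *)
    assert (Z0 : forall i z, (z < - Z.of_nat i)%Z -> trinomial 1 i z = 0).
    { clear. induction i as [|i IH]; intros z Hz; cbn [trinomial].
      - destruct (Z.eqb_spec z 0); [lia|easy].
      - rewrite !IH by lia; ring. }
    rewrite nth_padd, nth_map_mul.
    replace (Z.of_nat j - Z.of_nat (S k) + 1)%Z with (Z.of_nat j - Z.of_nat k)%Z by lia.
    destruct j as [|j]; cbn [nth].
    { rewrite Nat.add_0_r, Nat.mul_1_l, IH.
      rewrite (Z0 k (_ - Z.of_nat (S k) - 1)%Z), (Z0 k (_ - Z.of_nat (S k))%Z) by lia; ring. }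
    rewrite nth_padd, nth_map_mul.
    replace (Z.of_nat (S j) - Z.of_nat (S k))%Z with (Z.of_nat j - Z.of_nat k)%Z by lia.
    destruct j as [|j]; cbn [nth].
    { rewrite Nat.add_0_r, !Nat.mul_1_l, plus_INR, !IH.
      rewrite (Z0 k (Z.of_nat 0 - Z.of_nat k - 1)%Z) by lia; ring. }
    rewrite nth_padd, nth_map_mul.
    replace (Z.of_nat (S j) - Z.of_nat k - 1)%Z with (Z.of_nat j - Z.of_nat k)%Z by lia.
    (* The product ends in [0 :: pmul [] q], whose only entry agrees with the default value. *)
    replace (nth j [0%nat] 0%nat) with 0%nat by now destruct j as [|[|j]].
    rewrite Nat.add_0_r, !Nat.mul_1_l, !plus_INR, !IH; ring.
Qed.

Lemma T_central (k : nat) : INR (T k) = central 1 k.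
Proof. unfold T; rewrite nth_ppow_trinomial; f_equal; lia. Qed.

Lemma ell_central (n : nat) :
  INR (ell (S (S n))) = INR (S n) * (central 1 (S n) + central 1 n).
Proof. now rewrite ell_paths, !paths_trinomial. Qed.

Lemma GM_central (n : nat) : INR (length (GM n)) = central 1 n.
Proof. now rewrite GM_length, paths_trinomial. Qed.

Lemma sum_mult_pow_S (f : nat -> R) (n : nat) :
  sum_f_R0 (fun k => f k * 3 ^ (S n - k)) (S n) =
  3 * sum_f_R0 (fun k => f k * 3 ^ (n - k)) n + f (S n).
Proof.
  rewrite tech5, Nat.sub_diag, scal_sum; f_equal; [|simpl; ring].
  apply sum_eq; intros k Hk; replace (S n - k)%nat with (S (n - k)) by lia; simpl; ring.
Qed.

(** Both sides satisfy s(n + 1) = 3 s(n) + 2 T_(n+1); for the closed form of [ell_central] this is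
    [central_rec] at [a = 1]. *)
Lemma ell_sum_central (n : nat) :
  INR (ell (S (S n))) = 2 * sum_f_R0 (fun k => central 1 k * 3 ^ (n - k)) n.
Proof.
  rewrite ell_central; induction n as [|n IH].
  - simpl; ring.
  - rewrite sum_mult_pow_S; set (s := sum_f_R0 _ n) in *.
    assert (K := central_rec 1 n). rewrite !plus_INR, ?S_INR in *; simpl INR in *. lra.
Qed.

(** Coefficient of x^k in (1 - x)^(-1/2). *)
Definition cbin (k : nat) : R := C (2 * k) k / 4 ^ k.

Lemma cbin_0 : cbin 0 = 1.
Proof. unfold cbin; rewrite C_central_0; simpl; field. Qed.

Lemma cbin_S (k : nat) : 2 * INR (S k) * cbin (S k) = (2 * INR k + 1) * cbin k.
Proof.
  unfold cbin, Rdiv. assert (K := C_central_S k). assert (P := pow_lt 4 k ltac:(lra)).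
  replace (2 * INR (S k) * (C (2 * S k) (S k) * / 4 ^ S k)) with
    (2 * (INR (S k) * C (2 * S k) (S k)) * / 4 ^ S k) by ring.
  rewrite K; simpl pow; field; lra.
Qed.

Definition conv (f g : nat -> R) (n : nat) : R := sum_f_R0 (fun k => f k * g (n - k)%nat) n.

Lemma conv_S_l (f g : nat -> R) (n : nat) :
  conv f g (S n) = f 0%nat * g (S n) + conv (fun k => f (S k)) g n.
Proof. unfold conv; rewrite decomp_sum by lia; reflexivity. Qed.

Lemma conv_S_r (f g : nat -> R) (n : nat) :
  conv f g (S n) = f (S n) * g 0%nat + conv f (fun k => g (S k)) n.
Proof.
  unfold conv; rewrite tech5, Nat.sub_diag, Rplus_comm; f_equal.
  apply sum_eq; intros k Hk; do 2 f_equal; lia.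
Qed.

Lemma conv_ext (f f' g g' : nat -> R) (n : nat) :
  (forall k, f k = f' k) -> (forall k, g k = g' k) -> conv f g n = conv f' g' n.
Proof. intros Ef Eg; apply sum_eq; intros; now rewrite Ef, Eg. Qed.

Lemma conv_lin_l (f f' g : nat -> R) (u v : R) (n : nat) :
  conv (fun k => u * f k + v * f' k) g n = u * conv f g n + v * conv f' g n.
Proof.
  unfold conv; rewrite !scal_sum, <- sum_plus; apply sum_eq; intros; ring.
Qed.

Lemma conv_lin_r (f g g' : nat -> R) (u v : R) (n : nat) :
  conv f (fun k => u * g k + v * g' k) n = u * conv f g n + v * conv f g' n.
Proof.
  unfold conv; rewrite !scal_sum, <- sum_plus; apply sum_eq; intros; ring.
Qed.

(* The generating function factors as (1 - 2x - 3x^2)^(-1/2) = (1 - 3x)^(-1/2) (1 + x)^(-1/2);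
   both sides obey the same second-order recurrence. *)
Lemma central_conv (n : nat) :
  central 1 n = conv (fun k => 3 ^ k * cbin k) (fun k => (-1) ^ k * cbin k) n.
Proof.
  set (f := fun k => 3 ^ k * cbin k); set (g := fun k => (-1) ^ k * cbin k).
  (* With [f] and [g] read as power series, [X] and [Y] are the coefficients of (x f') g and f (x
     g'). The first-order equations of [f] and [g] give one recurrence each, and X + Y = n (f g)_n
     allows both to be eliminated. *)
  set (X := conv (fun k => INR k * f k) g).
  set (Y := conv f (fun k => INR k * g k)).
  assert (Ef : forall k, INR (S k) * f (S k) = 3 * (INR k * f k) + 3 / 2 * f k).
  { intros k; unfold f. assert (K := cbin_S k). simpl pow.
    replace (INR (S k) * (3 * 3 ^ k * cbin (S k))) with (3 ^ k * 3 / 2 * (2 * INR (S k) * cbin (S k)))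
      by field. rewrite K; field. }
  assert (Eg : forall k, INR (S k) * g (S k) = -1 * (INR k * g k) + - / 2 * g k).
  { intros k; unfold g. assert (K := cbin_S k). simpl pow.
    replace (INR (S k) * (-1 * (-1) ^ k * cbin (S k))) with
      (- (-1) ^ k / 2 * (2 * INR (S k) * cbin (S k))) by field. rewrite K; field. }
  assert (XS : forall m, X (S m) = 3 * X m + 3 / 2 * conv f g m).
  { intros m; unfold X; rewrite conv_S_l; simpl (INR 0).
    rewrite (conv_ext _ _ g g _ Ef), conv_lin_l by easy; ring. }
  assert (YS : forall m, Y (S m) = - Y m - / 2 * conv f g m).
  { intros m; unfold Y; rewrite conv_S_r; simpl (INR 0).
    rewrite (conv_ext f f _ _ _ ltac:(easy) Eg), conv_lin_r; ring. }
  assert (XY : forall m, X m + Y m = INR m * conv f g m).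
  { intros m; unfold X, Y, conv; rewrite scal_sum, <- sum_plus; apply sum_eq.
    intros k Hk; rewrite minus_INR by easy; ring. }
  assert (W : forall m, INR (m + 2) * conv f g (S (S m)) =
                 (2 * INR m + 3) * conv f g (S m) + 3 * INR (m + 1) * conv f g m).
  { intros m. assert (A0 := XY m); assert (A1 := XY (S m)); assert (A2 := XY (S (S m))).
    assert (B1 := XS m); assert (B2 := YS m); assert (B3 := XS (S m)); assert (B4 := YS (S m)).
    rewrite !plus_INR, ?S_INR in *; simpl INR in *. lra. }
  assert (B1 : cbin 1 = / 2).
  { assert (K := cbin_S 0); rewrite cbin_0 in K; simpl in K; lra. }
  enough (K : central 1 n = conv f g n /\ central 1 (S n) = conv f g (S n)) by apply K.
  induction n as [|n [I1 I2]].
  - rewrite central_0, central_1; unfold conv, f, g; simpl; rewrite cbin_0, B1; split; field.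
  - split; [easy|].
    assert (K := central_rec 1 n). rewrite I1, I2 in K.
    apply Rmult_eq_reg_l with (INR (n + 2)); [|rewrite plus_INR; simpl; assert (P := pos_INR n); lra].
    rewrite K, W; ring.
Qed.

(** Weighting by powers of 3 divides the series by 1 - 3x, which turns (1 - 3x)^(-1/2) into (1 -
    3x)^(-3/2), with coefficients (2k + 1) 3^k [cbin k]. *)
Lemma sum_central_conv (n : nat) :
  sum_f_R0 (fun k => central 1 k * 3 ^ (n - k)) n =
  conv (fun k => (2 * INR k + 1) * (3 ^ k * cbin k)) (fun k => (-1) ^ k * cbin k) n.
Proof.
  induction n as [|n IH].
  - unfold conv; simpl; rewrite cbin_0; ring.
  - rewrite sum_mult_pow_S, IH, central_conv, !conv_S_l.
    rewrite (conv_ext (fun k => (2 * INR (S k) + 1) * (3 ^ S k * cbin (S k)))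
      (fun k => 3 * ((2 * INR k + 1) * (3 ^ k * cbin k)) + 1 * (3 ^ S k * cbin (S k)))
      (fun k => (-1) ^ k * cbin k) (fun k => (-1) ^ k * cbin k)) by
      (easy || (intros k; assert (K := cbin_S k); simpl pow;
       replace (3 * ((2 * INR k + 1) * (3 ^ k * cbin k))) with
         (3 * 3 ^ k * ((2 * INR k + 1) * cbin k)) by ring; rewrite <- K; ring)).
    rewrite conv_lin_l; simpl INR; ring.
Qed.

Lemma ell_central_binomial_sum (n : nat) :
  INR (ell (S (S n))) =
    2 / 4 ^ n * sum_f_R0 (fun k => C (2 * k) k * C (2 * n - 2 * k) (n - k)
                                   * (2 * INR k + 1) * 3 ^ k * (-1) ^ (n - k)) n.
Proof.
  rewrite ell_sum_central, sum_central_conv; unfold conv; rewrite !scal_sum.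
  apply sum_eq; intros k Hk; unfold cbin.
  replace (2 * n - 2 * k)%nat with (2 * (n - k))%nat by lia.
  replace (4 ^ n) with (4 ^ k * 4 ^ (n - k)) by (rewrite <- pow_add; f_equal; lia).
  field; split; apply pow_nonzero; lra.
Qed.

(** After inserting [central_1_binomial] the powers of 3 merge, and each [C (2 * k) k] is multiplied
    by a column sum of Pascal's triangle; the induction is the hockey-stick identity. *)
Lemma ell_alternating_sum (n : nat) :
  INR (ell (S (S n))) =
    2 * sum_f_R0 (fun k => C (S n) (S k) * C (2 * k) k * (-1) ^ k * 3 ^ (n - k)) n.
Proof.
  rewrite ell_sum_central; f_equal; induction n as [|n IH].
  - simpl; rewrite !C_0_r, !C_diag; ring.
  - rewrite sum_mult_pow_S, IH, central_1_binomial, !tech5, !C_diag.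
    rewrite scal_sum, <- Rplus_assoc, <- sum_plus, Nat.sub_diag; f_equal; [|ring].
    apply sum_eq; intros k Hk; rewrite <- (pascal (S n)) by lia.
    replace (S n - k)%nat with (S (n - k)) by lia; simpl pow; ring.
Qed.

(** * Wallis' product and generating functions *)

Lemma cbin_pos (k : nat) : 0 < cbin k.
Proof.
  induction k as [|k IH]; [rewrite cbin_0; lra|].
  assert (K := cbin_S k); assert (P := pos_INR k); rewrite S_INR in K. nra.
Qed.

Definition wallis (n : nat) : R := RInt (fun x => sin x ^ n) 0 (PI / 2).

Lemma continuous_sin_pow (n : nat) (x : R) : continuous (fun x => sin x ^ n) x.
Proof. apply (ex_derive_continuous (fun x => sin x ^ n)); auto_derive; easy. Qed.

Lemma ex_RInt_sin_pow (n : nat) : ex_RInt (fun x => sin x ^ n) 0 (PI / 2).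
Proof. apply (ex_RInt_continuous (V := R_CompleteNormedModule)); intros; apply continuous_sin_pow. Qed.

(** Integrate the derivative of cos x sin^(n+1) x, which vanishes at both ends of the interval. *)
Lemma wallis_SS (n : nat) : INR (n + 2) * wallis (S (S n)) = INR (n + 1) * wallis n.
Proof.
  assert (D : is_RInt (fun x => INR (n + 1) * sin x ^ n - INR (n + 2) * sin x ^ (S (S n))) 0 (PI / 2)
     (minus (cos (PI / 2) * sin (PI / 2) ^ S n) (cos 0 * sin 0 ^ S n))).
  { apply (is_RInt_derive (fun x => cos x * sin x ^ S n)); intros x _.
    - auto_derive; [easy|]. rewrite !plus_INR; simpl (INR 1); simpl (INR 2).
      change (Nat.pred (S n)) with n.
      assert (E := sin2_cos2 x); unfold Rsqr in E.
      replace (match n with O => 1 | S _ => INR n + 1 end) with (INR n + 1)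
        by (destruct n; simpl; ring).
      simpl (sin x ^ S (S n)).
      replace (cos x * _) with ((INR n + 1) * sin x ^ n * (cos x * cos x)) by ring.
      replace (cos x * cos x) with (1 - sin x * sin x) by lra. ring.
    - apply (ex_derive_continuous (fun x => INR (n + 1) * sin x ^ n - INR (n + 2) * sin x ^ (S (S n)))).
      auto_derive; easy. }
  apply (is_RInt_unique (V := R_CompleteNormedModule)) in D.
  rewrite cos_PI2, sin_0 in D.
  assert (E : RInt (fun x => INR (n + 1) * sin x ^ n - INR (n + 2) * sin x ^ (S (S n))) 0 (PI / 2) =
    INR (n + 1) * wallis n - INR (n + 2) * wallis (S (S n))).
  { unfold wallis. rewrite (RInt_minus (V := R_CompleteNormedModule)
      (fun x => INR (n + 1) * sin x ^ n) (fun x => INR (n + 2) * sin x ^ (S (S n)))).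
    - rewrite (RInt_scal (V := R_CompleteNormedModule) (fun x => sin x ^ n)) by apply ex_RInt_sin_pow.
      rewrite (RInt_scal (V := R_CompleteNormedModule) (fun x => sin x ^ (S (S n)))) by apply ex_RInt_sin_pow.
      reflexivity.
    - apply (ex_RInt_scal (V := R_CompleteNormedModule) (fun x => sin x ^ n)), ex_RInt_sin_pow.
    - apply (ex_RInt_scal (V := R_CompleteNormedModule) (fun x => sin x ^ (S (S n)))), ex_RInt_sin_pow. }
  rewrite E in D. unfold minus, plus, opp in D; simpl in D. simpl. lra.
Qed.

Lemma wallis_0 : wallis 0 = PI / 2.
Proof.
  unfold wallis; simpl. rewrite (RInt_const (V := R_CompleteNormedModule)).
  unfold scal; simpl; unfold mult; simpl; ring.
Qed.

Lemma wallis_1 : wallis 1 = 1.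
Proof.
  unfold wallis. rewrite (is_RInt_unique (V := R_CompleteNormedModule) _ _ _
    (minus (- cos (PI / 2)) (- cos 0))).
  - rewrite cos_PI2, cos_0; unfold minus, plus, opp; simpl; ring.
  - apply (is_RInt_derive (fun x => - cos x)); intros x _.
    + auto_derive; [easy|ring].
    + apply continuous_sin_pow.
Qed.

Lemma wallis_S_le (n : nat) : wallis (S n) <= wallis n.
Proof.
  assert (P := PI_RGT_0).
  apply RInt_le; [lra|apply ex_RInt_sin_pow|apply ex_RInt_sin_pow|].
  intros x Hx. assert (0 <= sin x) by (apply sin_ge_0; lra).
  assert (K := pow_le (sin x) n H). assert (B := SIN_bound x). simpl; nra.
Qed.

(** By [wallis_SS] the product does not depend on [n]; its value is found at 0. *)
Lemma wallis_prod (n : nat) : INR (S n) * (wallis (S n) * wallis n) = PI / 2.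
Proof.
  induction n as [|n IH].
  - rewrite wallis_0, wallis_1; simpl; ring.
  - assert (K := wallis_SS n). rewrite !plus_INR in K; rewrite !S_INR in *; simpl INR in K.
    replace ((INR n + 1 + 1) * (wallis (S (S n)) * wallis (S n))) with
      (((INR n + 1 + 1) * wallis (S (S n))) * wallis (S n)) by ring.
    replace ((INR n + 1 + 1) * wallis (S (S n))) with ((INR n + 1) * wallis n) by lra.
    rewrite <- IH; ring.
Qed.

Lemma wallis_even (k : nat) : wallis (2 * k) = PI / 2 * cbin k.
Proof.
  induction k as [|k IH]; [rewrite cbin_0; simpl; rewrite wallis_0; ring|].
  replace (2 * S k)%nat with (S (S (2 * k))) by lia.
  assert (K := wallis_SS (2 * k)); rewrite IH in K; assert (B := cbin_S k).
  assert (P := pos_INR k).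
  rewrite !plus_INR, mult_INR in K; rewrite S_INR in B; simpl INR in K.
  apply Rmult_eq_reg_l with (2 * INR k + 2); [|lra].
  replace ((2 * INR k + 2) * (PI / 2 * cbin (S k))) with (PI / 2 * (2 * (INR k + 1) * cbin (S k))) by ring.
  rewrite B; lra.
Qed.

(** By monotonicity the square of [wallis (2 * k)] lies between its products with the next and the
    previous integral, and [wallis_prod] evaluates both products. *)
Lemma cbin_sqr_bounds (k : nat) :
  INR k * PI * cbin k ^ 2 <= 1 <= (INR k + / 2) * PI * cbin k ^ 2.
Proof.
  assert (P := PI_RGT_0). assert (Q := pos_INR k). assert (B := cbin_pos k).
  assert (W := wallis_even k).
  assert (Wp : 0 < wallis (2 * k)) by (rewrite W; nra).
  assert (M : forall u, u * (PI / 2 * cbin k) * (PI / 2 * cbin k) = PI / 2 * (u / 2 * PI * cbin k ^ 2))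
    by (intros; field).
  split.
  - destruct k as [|k]; [simpl; lra|].
    assert (K := wallis_prod (S (2 * k))). assert (L := wallis_S_le (S (2 * k))).
    replace (S (S (2 * k))) with (2 * S k)%nat in * by lia.
    rewrite mult_INR in K; simpl (INR 2) in K.
    apply Rmult_le_reg_l with (PI / 2); [lra|].
    specialize (M (2 * INR (S k))); rewrite <- W in M.
    replace (2 * INR (S k) / 2) with (INR (S k)) in M by field.
    rewrite <- M, Rmult_1_r, <- K, Rmult_assoc.
    apply Rmult_le_compat_l; [lra|]. apply Rmult_le_compat_l; lra.
  - assert (K := wallis_prod (2 * k)). assert (L := wallis_S_le (2 * k)).
    rewrite S_INR, mult_INR in K; simpl (INR 2) in K.
    apply Rmult_le_reg_l with (PI / 2); [lra|].
    specialize (M (2 * INR k + 1)); rewrite <- W in M.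
    replace ((2 * INR k + 1) / 2) with (INR k + / 2) in M by field.
    rewrite <- M, Rmult_1_r, <- K, Rmult_assoc.
    apply Rmult_le_compat_l; [lra|]. apply Rmult_le_compat_r; lra.
Qed.

(** From PI >= 2 and k + 1 <= 2k for k >= 1. The factor k + 1 makes the bound informative at 0
    too. *)
Lemma cbin_sqr_le (k : nat) : INR (S k) * cbin k ^ 2 <= 1.
Proof.
  destruct k as [|k]; [rewrite cbin_0; simpl; lra|].
  destruct (cbin_sqr_bounds (S k)) as [K _].
  assert (P : 2 <= PI) by (assert (Q := PI2_1); lra).
  assert (Q := pos_INR k). rewrite !S_INR in *. assert (B := pow2_ge_0 (cbin (S k))).
  apply Rle_trans with (2 := K). apply Rmult_le_compat_r; nra.
Qed.

Lemma cbin_le_1 (k : nat) : cbin k <= 1.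
Proof.
  assert (K := cbin_sqr_le k); assert (Q := pos_INR k); rewrite S_INR in K; assert (B := cbin_pos k).
  nra.
Qed.

Lemma cbin_CV_disk (x : R) : Rabs x < 1 -> Rbar_lt (Rabs x) (CV_radius cbin).
Proof.
  intros Hx; apply Rbar_lt_le_trans with 1; [easy|].
  apply (proj1 (CV_radius_bounded cbin)); exists 1; intros n.
  rewrite pow1, Rmult_1_r, Rabs_pos_eq; [apply cbin_le_1|apply Rlt_le, cbin_pos].
Qed.

(** Coefficientwise the equation 2y' = 2xy' + y is [cbin_S]. *)
Lemma cbin_PSeries_ODE (x : R) : Rabs x < 1 ->
  2 * (1 - x) * PSeries (PS_derive cbin) x = PSeries cbin x.
Proof.
  intros Hx. assert (Hb := cbin_CV_disk x Hx).
  assert (Eb : ex_pseries cbin x) by now apply CV_radius_inside.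
  assert (Ed : ex_pseries (PS_derive cbin) x)
    by (apply CV_radius_inside; now rewrite CV_radius_derive).
  assert (E : PSeries (PS_scal 2 (PS_derive cbin)) x =
     PSeries (PS_plus (PS_scal 2 (PS_incr_1 (PS_derive cbin))) cbin) x).
  { apply PSeries_ext; intros n.
    unfold PS_scal, PS_plus, PS_derive, PS_incr_1, scal, plus; simpl; unfold mult; simpl.
    assert (K := cbin_S n). destruct n as [|n]; simpl in *; [unfold zero; simpl; lra|]; lra. }
  assert (Ei : ex_pseries (PS_incr_1 (PS_derive cbin)) x) by now apply ex_pseries_incr_1.
  rewrite PSeries_plus in E; [|apply ex_pseries_scal; [apply Rmult_comm|easy]|easy].
  rewrite !PSeries_scal, PSeries_incr_1 in E. lra.
Qed.

(** The differential equation makes y sqrt(1 - x) constant on the disk, with value 1 at the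
    origin. *)
Lemma cbin_PSeries (x : R) : Rabs x < 1 -> PSeries cbin x = / sqrt (1 - x).
Proof.
  intros Hx.
  set (h := fun y => PSeries cbin y * sqrt (1 - y)).
  assert (D : forall y, Rabs y < 1 -> is_derive h y 0).
  { intros y Hy. assert (O := cbin_PSeries_ODE y Hy).
    assert (Dp := is_derive_PSeries cbin y (cbin_CV_disk y Hy)).
    apply Rabs_def2 in Hy. assert (S0 : 0 < sqrt (1 - y)) by (apply sqrt_lt_R0; lra).
    assert (Ds : is_derive (fun y => sqrt (1 - y)) y (- / (2 * sqrt (1 - y)))).
    { auto_derive; [lra|]. unfold Rminus; field. unfold Rminus in S0; lra. }
    assert (K := is_derive_mult _ _ _ _ _ Dp Ds).
    unfold h. replace 0 with (plus (mult (PSeries (PS_derive cbin) y) (sqrt (1 - y)))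
       (mult (PSeries cbin y) (- / (2 * sqrt (1 - y))))); [exact K|].
    unfold plus, mult; simpl. rewrite <- O.
    replace (1 - y) with (sqrt (1 - y) * sqrt (1 - y)) at 2 by (apply sqrt_sqrt; lra).
    field; lra. }
  assert (h0 : h 0 = 1).
  { unfold h; rewrite PSeries_0, cbin_0, Rminus_0_r, sqrt_1; ring. }
  assert (Hx' := Rabs_def2 _ _ Hx).
  assert (E : h x = 1).
  { destruct (Rtotal_order x 0) as [L|[->|G]]; [|easy|].
    - rewrite <- h0; apply (eq_is_derive (V := R_NormedModule) h); [|easy].
      intros y Hy; apply D, Rabs_def1; lra.
    - rewrite <- h0; symmetry; apply (eq_is_derive (V := R_NormedModule) h); [|easy].
      intros y Hy; apply D, Rabs_def1; lra. }
  unfold h in E. assert (S0 : 0 < sqrt (1 - x)) by (apply sqrt_lt_R0; lra).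
  apply Rmult_eq_reg_r with (sqrt (1 - x)); [|lra]. rewrite E; field; lra.
Qed.

Lemma cbin_is_series (x : R) : Rabs x < 1 ->
  is_series (fun n => cbin n * x ^ n) (/ sqrt (1 - x)).
Proof.
  intros Hx. rewrite <- cbin_PSeries by easy.
  apply Series_correct, ex_series_Rabs, CV_disk_inside, cbin_CV_disk, Hx.
Qed.

Lemma cbin_ex_series_Rabs (x : R) : Rabs x < 1 -> ex_series (fun n => Rabs (cbin n * x ^ n)).
Proof. intros Hx; apply CV_disk_inside, cbin_CV_disk, Hx. Qed.

(** Cauchy product of the [cbin] series at 3x and at -x; the first argument dictates the radius
    1/3. *)
Lemma central_is_series (x : R) : Rabs x < 1 / 3 ->
  is_series (fun n => central 1 n * x ^ n) (/ sqrt (1 - 2 * x - 3 * x ^ 2)).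
Proof.
  intros Hx. assert (Hx' := Rabs_def2 _ _ Hx).
  assert (H3 : Rabs (3 * x) < 1) by (apply Rabs_def1; lra).
  assert (H1 : Rabs (- x) < 1) by (apply Rabs_def1; lra).
  assert (K := is_series_mult _ _ _ _ (cbin_is_series _ H3) (cbin_is_series _ H1)
                 (cbin_ex_series_Rabs _ H3) (cbin_ex_series_Rabs _ H1)).
  replace (1 - 2 * x - 3 * x ^ 2) with ((1 - 3 * x) * (1 - - x)) by ring.
  rewrite sqrt_mult, Rinv_mult by lra.
  revert K; apply is_series_ext; intros n.
  rewrite central_conv; unfold conv; rewrite (Rmult_comm _ (x ^ n)), scal_sum.
  apply sum_eq; intros k Hk. replace (x ^ n) with (x ^ k * x ^ (n - k)).
  - rewrite Rpow_mult_distr. replace (- x) with (-1 * x) by ring. rewrite Rpow_mult_distr; ring.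
  - rewrite <- pow_add; f_equal; lia.
Qed.

Lemma central_nonneg (n : nat) : 0 <= central 1 n.
Proof. rewrite <- T_central; apply pos_INR. Qed.

Lemma ell_is_series (x : R) : Rabs x < 1 / 3 ->
  is_series (fun n => INR (ell n) * x ^ n)
    (2 * x ^ 2 / ((1 - 3 * x) * sqrt (1 - 2 * x - 3 * x ^ 2))).
Proof.
  intros Hx. assert (Hx' := Rabs_def2 _ _ Hx).
  assert (H3 : Rabs (3 * x) < 1) by (apply Rabs_def1; lra).
  assert (A : ex_series (fun n => Rabs (central 1 n * x ^ n))).
  { eexists. eapply is_series_ext; [|apply (central_is_series (Rabs x)); now rewrite Rabs_Rabsolu].
    intros n; rewrite Rabs_mult, <- RPow_abs, (Rabs_pos_eq (central 1 n)); [easy|apply central_nonneg]. }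
  assert (G : ex_series (fun n => Rabs ((3 * x) ^ n))).
  { eexists. eapply is_series_ext; [|apply (is_series_geom (Rabs (3 * x))); now rewrite Rabs_Rabsolu].
    intros n; simpl; now rewrite RPow_abs. }
  assert (K := is_series_mult _ _ _ _ (central_is_series x Hx) (is_series_geom _ H3) A G).
  apply (is_series_scal (K := R_AbsRing) (2 * x ^ 2)) in K.
  (* The terms at 0 and 1 vanish; shifting past them accounts for the factor x^2. *)
  apply is_series_decr_1. apply is_series_decr_1.
  rewrite ell_0, ell_1; simpl (INR 0).
  replace (plus _ _) with (scal (2 * x ^ 2) (/ sqrt (1 - 2 * x - 3 * x ^ 2) * / (1 - 3 * x))).
  - revert K; apply is_series_ext; intros n.
    unfold scal; simpl; unfold mult; simpl. rewrite ell_sum_central.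
    set (s := sum_f_R0 _ n).
    replace s with (x ^ n * sum_f_R0 (fun k => central 1 k * 3 ^ (n - k)) n).
    + ring.
    + unfold s; rewrite scal_sum; apply sum_eq; intros k Hk.
      rewrite Rpow_mult_distr. replace (x ^ n) with (x ^ k * x ^ (n - k)); [ring|].
      rewrite <- pow_add; f_equal; lia.
  - unfold plus, opp, scal; simpl; unfold mult; simpl. unfold Rdiv; rewrite Rinv_mult; ring.
Qed.

(** * Asymptotics *)

Lemma is_lim_seq_sqrt (u : nat -> R) (l : R) :
  0 <= l -> is_lim_seq u l -> is_lim_seq (fun n => sqrt (u n)) (sqrt l).
Proof. intros Hl; apply (is_lim_seq_continuous sqrt), continuity_pt_sqrt, Hl. Qed.

Lemma is_lim_seq_inv_S : is_lim_seq (fun n => / INR (S n)) 0.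
Proof.
  apply (is_lim_seq_inv (fun n => INR (S n)) p_infty); [|easy].
  apply -> (is_lim_seq_incr_1 INR); apply is_lim_seq_INR.
Qed.

Lemma sum_dominated_tail (h M : nat -> R) (m n : nat) :
  (forall j, (j <= n)%nat -> Rabs (h j) <= M j) -> (m <= n)%nat ->
  Rabs (sum_f_R0 h n - sum_f_R0 h m) <= sum_f_R0 M n - sum_f_R0 M m.
Proof.
  induction n as [|n IH]; intros Hh Hm.
  - replace m with 0%nat by lia; rewrite !Rminus_diag, Rabs_R0; lra.
  - destruct (Nat.eq_dec m (S n)) as [->|Ne].
    + rewrite !Rminus_diag, Rabs_R0; lra.
    + rewrite !tech5. assert (I : forall j, (j <= n)%nat -> Rabs (h j) <= M j) by auto.
      specialize (IH I ltac:(lia)). specialize (Hh (S n) ltac:(lia)).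
      replace (sum_f_R0 h n + h (S n) - sum_f_R0 h m) with
        ((sum_f_R0 h n - sum_f_R0 h m) + h (S n)) by ring.
      assert (K := Rabs_triang (sum_f_R0 h n - sum_f_R0 h m) (h (S n))). lra.
Qed.

Lemma is_lim_seq_sum_f_R0 (f : nat -> nat -> R) (g : nat -> R) (m : nat) :
  (forall j, is_lim_seq (fun n => f n j) (g j)) ->
  is_lim_seq (fun n => sum_f_R0 (f n) m) (sum_f_R0 g m).
Proof.
  intros Hf; induction m as [|m IH]; simpl; [apply Hf|].
  now apply is_lim_seq_plus'.
Qed.

Lemma is_series_lim (a : nat -> R) (l : R) : is_series a l -> is_lim_seq (sum_f_R0 a) l.
Proof. intros K; apply is_lim_seq_Reals. now apply is_series_Reals in K. Qed.

(** Dominated convergence with a growing number of terms. Cut at [m]: the tail of [M], the tail of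
    [g] and the convergence of the finite head each cost less than a quarter of [eps]. *)
Lemma tannery (f : nat -> nat -> R) (g M : nat -> R) (l lM : R) :
  (forall j, is_lim_seq (fun n => f n j) (g j)) ->
  (forall n j, (j <= n)%nat -> Rabs (f n j) <= M j) ->
  is_series M lM -> is_series g l ->
  is_lim_seq (fun n => sum_f_R0 (f n) n) l.
Proof.
  intros Hf HM SM Sg. apply is_series_lim in SM; apply is_series_lim in Sg.
  assert (SM' := SM); assert (Sg' := Sg).
  apply is_lim_seq_spec in SM'; apply is_lim_seq_spec in Sg'.
  apply is_lim_seq_spec; intros eps.
  destruct (SM' (pos_div_2 (pos_div_2 eps))) as [N1 H1].
  destruct (Sg' (pos_div_2 (pos_div_2 eps))) as [N2 H2].
  set (m := Nat.max N1 N2).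
  assert (K := is_lim_seq_sum_f_R0 f g m Hf).
  apply is_lim_seq_spec in K; destruct (K (pos_div_2 (pos_div_2 eps))) as [N3 H3].
  exists (Nat.max m N3); intros n Hn.
  specialize (H1 m ltac:(lia)); specialize (H2 m ltac:(lia)); specialize (H3 n ltac:(lia)).
  assert (A := sum_dominated_tail (f n) M m n (HM n) ltac:(lia)).
  (* The partial sums of [M] increase, because [HM] on the diagonal puts an absolute value below
     each term. *)
  assert (B : sum_f_R0 M n <= lM).
  { apply (is_lim_seq_incr_compare (sum_f_R0 M) lM SM). intros k; rewrite tech5.
    assert (P := Rabs_pos (f (S k) (S k))); specialize (HM (S k) (S k) (le_n _)); lra. }
  simpl in *. apply Rabs_def2 in H1; apply Rabs_def2 in H2; apply Rabs_def2 in H3.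
  apply Rabs_le_between in A. apply Rabs_def1; lra.
Qed.

Lemma cbin_asymptotic : is_lim_seq (fun n => INR n * cbin n ^ 2) (/ PI).
Proof.
  assert (P := PI_RGT_0).
  (* The lower bound is n / (PI (n + 1)), from weakening n + 1/2 to n + 1. *)
  apply is_lim_seq_le_le with (fun n => / PI - / PI * / INR (S n)) (fun _ => / PI).
  - intros n; destruct (cbin_sqr_bounds n) as [U L].
    assert (Q := pos_INR n). rewrite S_INR. assert (B := pow2_ge_0 (cbin n)).
    set (y := cbin n ^ 2) in *. split.
    + apply Rmult_le_reg_l with (PI * (INR n + 1)); [nra|].
      replace (PI * (INR n + 1) * (/ PI - / PI * / (INR n + 1))) with (INR n) by (field; lra).
      apply Rle_trans with (INR n * ((INR n + / 2) * PI * y)); [nra|].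
      assert (0 <= INR n * PI * y) by (apply Rmult_le_pos; [nra|easy]). nra.
    + apply Rmult_le_reg_l with PI; [easy|]. rewrite Rinv_r by lra. lra.
  - replace (Finite (/ PI)) with (Finite (/ PI - / PI * 0)) by (f_equal; ring).
    apply is_lim_seq_minus'; [apply is_lim_seq_const|].
    apply is_lim_seq_mult'; [apply is_lim_seq_const|apply is_lim_seq_inv_S].
  - apply is_lim_seq_const.
Qed.

Lemma cbin_sqr_lim_0 : is_lim_seq (fun n => cbin n ^ 2) 0.
Proof.
  apply is_lim_seq_le_le with (fun _ => 0) (fun n => / INR (S n)).
  - intros n; split; [apply pow2_ge_0|].
    assert (P := lt_0_INR (S n) ltac:(lia)).
    apply Rmult_le_reg_l with (INR (S n)); [easy|]. rewrite Rinv_r by lra. apply cbin_sqr_le.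
  - apply is_lim_seq_const.
  - apply is_lim_seq_inv_S.
Qed.

(** Termwise limit for [tannery]. Reindexed by [j], the square is n [cbin n ^ 2] plus j + 1 times a
    null sequence. *)
Lemma cbin_asymptotic_shift (j : nat) :
  is_lim_seq (fun n => sqrt (INR (S n)) * cbin (n - j)) (sqrt (/ PI)).
Proof.
  apply (is_lim_seq_incr_n _ j).
  apply is_lim_seq_ext with (fun n => sqrt (INR n * cbin n ^ 2 + INR (S j) * cbin n ^ 2)).
  - intros n. replace (n + j - j)%nat with n by lia.
    replace (INR n * cbin n ^ 2 + INR (S j) * cbin n ^ 2) with (INR (S (n + j)) * cbin n ^ 2)
      by (rewrite !S_INR, plus_INR; ring).
    rewrite sqrt_mult by (apply pos_INR || apply pow2_ge_0).
    rewrite sqrt_pow2; [easy|apply Rlt_le, cbin_pos].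
  - apply is_lim_seq_sqrt; [apply Rlt_le, Rinv_0_lt_compat, PI_RGT_0|].
    replace (/ PI) with (/ PI + INR (S j) * 0) by ring.
    apply is_lim_seq_plus'; [apply cbin_asymptotic|].
    apply is_lim_seq_mult'; [apply is_lim_seq_const|apply cbin_sqr_lim_0].
Qed.

(** Majorant for [tannery], uniform in [n]: n + 1 <= (j + 1)(n - j + 1) bounds the square by j + 1
    <= 2^j. Against (1/3)^j a summable (2/3)^j remains. *)
Lemma sqrt_b_le (n j : nat) : (j <= n)%nat -> sqrt (INR (S n)) * cbin (n - j) <= 2 ^ j.
Proof.
  intros Hj. assert (B := cbin_pos (n - j)).
  apply Rsqr_incr_0_var; [|apply pow_le; lra].
  rewrite Rsqr_mult, Rsqr_sqrt by apply pos_INR.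
  assert (K := cbin_sqr_le (n - j)).
  assert (E : INR (S n) <= INR (S j) * INR (S (n - j))).
  { rewrite <- mult_INR; apply le_INR; nia. }
  assert (F : INR (S j) <= 2 ^ j).
  { clear; induction j as [|j IH]; [simpl; lra|].
    rewrite S_INR; assert (1 <= 2 ^ j) by (apply pow_R1_Rle; lra). simpl pow; lra. }
  assert (G : 1 <= 2 ^ j) by (apply pow_R1_Rle; lra).
  assert (I := pos_INR j). rewrite S_INR in F.
  unfold Rsqr; rewrite S_INR in E.
  apply Rle_trans with (INR (S j)).
  - replace (cbin (n - j) * cbin (n - j)) with (cbin (n - j) ^ 2) by ring.
    apply Rle_trans with (INR (S j) * INR (S (n - j)) * cbin (n - j) ^ 2).
    + apply Rmult_le_compat_r; [apply pow2_ge_0|]. rewrite S_INR; lra.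
    + apply Rle_trans with (INR (S j) * 1); [rewrite Rmult_assoc|lra].
      apply Rmult_le_compat_l; [apply pos_INR|easy].
  - rewrite S_INR; nra.
Qed.

Lemma conv_comm (f g : nat -> R) (n : nat) : conv f g n = conv g f n.
Proof.
  revert f; induction n as [|n IH]; intros f.
  - unfold conv; simpl; ring.
  - rewrite conv_S_l, conv_S_r, IH; ring.
Qed.

(** Reverse the convolution, so that [cbin (n - j)] carries the decay 1 / sqrt(PI n) and the rest
    sums to the series of (1 - x)^(-1/2) at x = -1/3, which is sqrt 3 / 2. *)
Lemma central_asymptotic :
  is_lim_seq (fun n => sqrt (INR (S n)) * (central 1 n / 3 ^ n)) (sqrt (3 / PI) / 2).
Proof.
  assert (P := PI_RGT_0).
  apply is_lim_seq_ext with
    (fun n => sum_f_R0 (fun j => sqrt (INR (S n)) * cbin (n - j) * (cbin j * (- / 3) ^ j)) n).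
  - intros n; rewrite central_conv, conv_comm; unfold conv, Rdiv.
    rewrite <- Rmult_assoc, (Rmult_comm (_ * _) (/ 3 ^ n)), <- Rmult_assoc, scal_sum.
    apply sum_eq; intros j Hj.
    replace (3 ^ n) with (3 ^ j * 3 ^ (n - j)) by (rewrite <- pow_add; f_equal; lia).
    replace (- / 3) with (-1 * / 3) by ring. rewrite Rpow_mult_distr, pow_inv.
    field; split; apply pow_nonzero; lra.
  - assert (A : Rabs (- / 3) < 1) by (apply Rabs_def1; lra).
    apply tannery with (g := fun j => sqrt (/ PI) * (cbin j * (- / 3) ^ j))
      (M := fun j => (2 / 3) ^ j) (lM := / (1 - 2 / 3)).
    + intros j; apply is_lim_seq_mult'; [apply cbin_asymptotic_shift|apply is_lim_seq_const].
    + intros n j Hj. assert (B := cbin_pos (n - j)); assert (B' := cbin_pos j); assert (B1 := cbin_le_1 j).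
      assert (S0 := sqrt_pos (INR (S n))).
      rewrite !Rabs_mult, (Rabs_pos_eq (sqrt _)), (Rabs_pos_eq (cbin (n - j))), (Rabs_pos_eq (cbin j)) by lra.
      rewrite <- RPow_abs, Rabs_Ropp, (Rabs_pos_eq (/ 3)) by lra.
      replace (2 / 3) with (2 * / 3) by field. rewrite Rpow_mult_distr.
      assert (Q : 0 < (/ 3) ^ j) by (apply pow_lt; lra).
      apply Rmult_le_compat; [nra|nra|now apply sqrt_b_le|nra].
    + apply is_series_geom; apply Rabs_def1; lra.
    + replace (sqrt (3 / PI) / 2) with (scal (sqrt (/ PI)) (/ sqrt (1 - - / 3))).
      * apply (is_series_scal (K := R_AbsRing) (V := R_NormedModule) _ (fun j => cbin j * (- / 3) ^ j)).
        now apply cbin_is_series.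
      * unfold scal; simpl; unfold mult; simpl.
        replace (1 - - / 3) with (2 ^ 2 / 3) by field. unfold Rdiv.
        rewrite !sqrt_mult, sqrt_pow2, !sqrt_inv by
          (try apply Rlt_le, Rinv_0_lt_compat; lra).
        assert (sqrt 3 > 0) by (apply sqrt_lt_R0; lra).
        assert (sqrt PI > 0) by (apply sqrt_lt_R0; lra). field; lra.
Qed.

Lemma ratio_lim : is_lim_seq (fun n => INR (S n) / INR (S (S n))) 1.
Proof.
  apply is_lim_seq_ext with (fun n => 1 - / INR (S (S n))).
  - intros n; assert (P := pos_INR n); rewrite !S_INR; field; lra.
  - replace (Finite 1) with (Finite (1 - 0)) by (f_equal; ring).
    apply is_lim_seq_minus'; [apply is_lim_seq_const|].
    apply -> (is_lim_seq_incr_1 (fun n => / INR (S n))); apply is_lim_seq_inv_S.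
Qed.

(** Relative to 3^n, the term of index n + 1 counts three times and that of index n once: four
    halves of sqrt(3 / PI). *)
Lemma central_sum_asymptotic :
  is_lim_seq (fun n => sqrt (INR (S (S n))) * ((central 1 (S n) + central 1 n) / 3 ^ n))
    (2 * sqrt (3 / PI)).
Proof.
  assert (K := central_asymptotic).
  apply is_lim_seq_ext with (fun n =>
    3 * (sqrt (INR (S (S n))) * (central 1 (S n) / 3 ^ S n)) +
    sqrt (/ (INR (S n) / INR (S (S n)))) * (sqrt (INR (S n)) * (central 1 n / 3 ^ n))).
  - intros n; assert (P := lt_0_INR (S n) ltac:(lia)); assert (Q := lt_0_INR (S (S n)) ltac:(lia)).
    rewrite Rinv_div, <- (Rmult_assoc (sqrt (_ / _))), <- sqrt_mult by
      (apply Rlt_le; try apply Rdiv_lt_0_compat; lra).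
    replace (INR (S (S n)) / INR (S n) * INR (S n)) with (INR (S (S n))) by (field; lra).
    simpl pow; field; apply pow_nonzero; lra.
  - replace (2 * sqrt (3 / PI)) with
      (3 * (sqrt (3 / PI) / 2) + sqrt (/ 1) * (sqrt (3 / PI) / 2))
      by (rewrite Rinv_1, sqrt_1; field).
    apply is_lim_seq_plus'; apply is_lim_seq_mult'; [apply is_lim_seq_const| | |exact K].
    + apply -> (is_lim_seq_incr_1 (fun n => sqrt (INR (S n)) * (central 1 n / 3 ^ n))); exact K.
    + apply is_lim_seq_sqrt; [rewrite Rinv_1; lra|].
      apply (is_lim_seq_inv _ 1); [apply ratio_lim|].
      intros E; injection E; lra.
Qed.

(** Normalized by the same root as [central_sum_asymptotic], so that it cancels in the quotient
    [iGM]. *)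
Lemma central_SS_asymptotic :
  is_lim_seq (fun n => sqrt (INR (S (S n))) * (central 1 (S (S n)) / 3 ^ S (S n)))
    (sqrt (3 / PI) / 2).
Proof.
  assert (K := central_asymptotic). apply (is_lim_seq_incr_n _ 2) in K.
  apply is_lim_seq_ext with (fun n => sqrt (INR (S (S n)) / INR (S (S (S n)))) *
    (sqrt (INR (S (n + 2))) * (central 1 (n + 2) / 3 ^ (n + 2)))).
  - intros n; assert (P := lt_0_INR (S (S n)) ltac:(lia)); assert (Q := lt_0_INR (S (S (S n))) ltac:(lia)).
    replace (n + 2)%nat with (S (S n)) by lia.
    rewrite <- Rmult_assoc, <- sqrt_mult by
      (apply Rlt_le; try apply Rdiv_lt_0_compat; lra).
    do 2 f_equal; field; lra.
  - replace (sqrt (3 / PI) / 2) with (sqrt 1 * (sqrt (3 / PI) / 2)) by (rewrite sqrt_1; field).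
    apply is_lim_seq_mult'; [|exact K].
    apply is_lim_seq_sqrt; [lra|].
    apply -> (is_lim_seq_incr_1 (fun n => INR (S n) / INR (S (S n)))); apply ratio_lim.
Qed.

Lemma ell_asymptotic :
  Un_cv (fun n => INR (ell n) / (2 * 3 ^ n / 9 * sqrt (3 * INR n / PI))) 1.
Proof.
  assert (P := PI_RGT_0).
  assert (S3 : 0 < sqrt (3 / PI)) by (apply sqrt_lt_R0, Rdiv_lt_0_compat; lra).
  apply is_lim_seq_Reals, (is_lim_seq_incr_n _ 2).
  apply is_lim_seq_ext with (fun n => INR (S n) / INR (S (S n)) *
    (sqrt (INR (S (S n))) * ((central 1 (S n) + central 1 n) / 3 ^ n)) / (2 * sqrt (3 / PI))).
  - intros n; replace (n + 2)%nat with (S (S n)) by lia.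
    assert (Q := lt_0_INR (S (S n)) ltac:(lia)).
    rewrite ell_central.
    replace (3 * INR (S (S n)) / PI) with (INR (S (S n)) * (3 / PI)) by (field; lra).
    rewrite sqrt_mult by (apply Rlt_le; try apply Rdiv_lt_0_compat; lra).
    (* One of the two roots cancels the root in the denominator, the other feeds
       [central_sum_asymptotic]. *)
    assert (E : INR (S (S n)) = sqrt (INR (S (S n))) * sqrt (INR (S (S n)))) by (rewrite sqrt_sqrt; lra).
    assert (Q' : 0 < sqrt (INR (S (S n)))) by now apply sqrt_lt_R0.
    set (q := sqrt (INR (S (S n)))) in *. rewrite E.
    simpl pow; field; repeat split; try lra. apply pow_nonzero; lra.
  - replace (Finite 1) with (Finite (1 * (2 * sqrt (3 / PI)) / (2 * sqrt (3 / PI))))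
      by (f_equal; field; lra).
    apply is_lim_seq_div'; [|apply is_lim_seq_const|lra].
    apply is_lim_seq_mult'; [apply ratio_lim|apply central_sum_asymptotic].
Qed.

(** The numerator has limit 2 sqrt(3 / PI), the denominator 4 times sqrt(3 / PI) / 2; the 9 of 4/9
    is the ratio of 3^(n+2) to 3^n. *)
Lemma iGM_asymptotic : Un_cv (fun n => iGM n / (4 / 9 * INR n)) 1.
Proof.
  assert (P := PI_RGT_0).
  assert (S3 : 0 < sqrt (3 / PI)) by (apply sqrt_lt_R0, Rdiv_lt_0_compat; lra).
  apply is_lim_seq_Reals, (is_lim_seq_incr_n _ 2).
  apply is_lim_seq_ext with (fun n => INR (S n) / INR (S (S n)) *
    ((sqrt (INR (S (S n))) * ((central 1 (S n) + central 1 n) / 3 ^ n)) /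
     (4 * (sqrt (INR (S (S n))) * (central 1 (S (S n)) / 3 ^ S (S n)))))).
  - intros n; replace (n + 2)%nat with (S (S n)) by lia.
    unfold iGM; rewrite ell_central, GM_central.
    assert (Q := lt_0_INR (S (S n)) ltac:(lia)).
    assert (Q' : 0 < sqrt (INR (S (S n)))) by now apply sqrt_lt_R0.
    (* Dividing by the number of paths needs strict positivity, which the recurrence with positive
       coefficients propagates. *)
    assert (C1 : 0 < central 1 (S (S n))).
    { clear. induction n as [|n IH]; [simpl; lra|].
      assert (K := central_rec 1 (S n)). assert (N := central_nonneg (S n)).
      assert (I := pos_INR n). rewrite !plus_INR, !S_INR in K; simpl INR in K.
      assert (0 < central 1 (S (S n)) * (2 * (INR n + 1) + 3)) by (apply Rmult_lt_0_compat; lra).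
      assert (0 <= central 1 (S n) * (INR n + 2)) by (apply Rmult_le_pos; lra).
      apply Rmult_lt_reg_l with (INR n + 3); [lra|]. lra. }
    simpl pow. field. repeat split; try lra. apply pow_nonzero; lra.
  - replace (Finite 1) with (Finite (1 * (2 * sqrt (3 / PI) / (4 * (sqrt (3 / PI) / 2)))))
      by (f_equal; field; lra).
    apply is_lim_seq_mult'; [apply ratio_lim|].
    apply is_lim_seq_div'; [apply central_sum_asymptotic| |lra].
    apply is_lim_seq_mult'; [apply is_lim_seq_const|apply central_SS_asymptotic].
Qed.

Theorem mainTheorem10 :
  (forall x : R, Rabs x < 1/3 ->
     infinite_sum (fun n => INR (ell n) * x ^ n)
       (2 * x ^ 2 / ((1 - 3 * x) * sqrt (1 - 2 * x - 3 * x ^ 2))))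
  /\
  (forall n : nat,
     INR (ell (n + 2)) =
       2 * sum_f_R0 (fun k => INR (T k) * 3 ^ (n - k)) n
     /\
     INR (ell (n + 2)) =
       2 / 4 ^ n * sum_f_R0 (fun k => C (2 * k) k * C (2 * n - 2 * k) (n - k)
                                      * (2 * INR k + 1) * 3 ^ k * (-1) ^ (n - k)) n
     /\
     INR (ell (n + 2)) =
       2 * sum_f_R0 (fun k => C (n + 1) (k + 1) * C (2 * k) k * (-1) ^ k * 3 ^ (n - k)) n)
  /\
  Un_cv (fun n => INR (ell n) / (2 * 3 ^ n / 9 * sqrt (3 * INR n / PI))) 1
  /\
  Un_cv (fun n => iGM n / (4 / 9 * INR n)) 1.
Proof.
  split; [intros x Hx; now apply is_series_Reals, ell_is_series|].
  split; [|split; [apply ell_asymptotic|apply iGM_asymptotic]].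
  intros n; replace (n + 2)%nat with (S (S n)) by lia; repeat split.
  - rewrite ell_sum_central; f_equal; apply sum_eq; intros k _; now rewrite T_central.
  - apply ell_central_binomial_sum.
  - rewrite ell_alternating_sum; f_equal; apply sum_eq; intros k _.
    now rewrite !Nat.add_1_r.
Qed.
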